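(* Let $\beta\in(1/2,1)$, $r>0$, and assume the standing assumptions below (bounded continuous densities and tail condition (T)). Suppose \[ \max_{q\in(0,1]}\Big(\tfrac{1+q}{2}-\alpha(q,r)-\beta\Big)<0 . \] Then, under the coupling described below, for every $c>0$, \[ \Pr\big(\mathrm{HC}_n^{(1)}>\mathrm{HC}_n^{(0)}+c\big)\to0\qquad(n\to\infty). \]
   Context: Standing assumptions: $\epsilon_n=n^{-\beta}$. For each $n$ and $1\le i\le n$, $G_{n,i}$ is a probability distribution on $(0,1)$ with $G_{n,i}(t)\ge t$ for $t\in(0,1)$, having a continuous density $f_{n,i}$ with $\sup_x f_{n,i}(x)\le C$, where $C<\infty$ does not depend on $n,i$. Tail condition (T): $\alpha:[0,1]\times(0,\infty)\to[0,\infty)$ is continuous, nondecreasing in $q$, nonincreasing in $r$, and there is $\delta_n\to0$ such that for all $n$, $i\le n$, $q\in(0,1]$, with $X\sim G_{n,i}$: $|-\log\Pr(X<n^{-q})-\alpha(q,r)\log n|\le\delta_n\log n$. Coupling: on one probability space, let $I\subset\{1,\dots,n\}$ be random with each $i$ included independently with probability $\epsilon_n$; let $Q^{(0)}_1,\dots,Q^{(0)}_n$ be i.i.d. $\mathrm{Unif}(0,1)$ independent of $I$; for $i\in I$ let $Q^{(1)}_i\sim G_{n,i}$, drawn independently of everything else; for $i\notin I$ let $Q^{(1)}_i=Q^{(0)}_i$. For $h\in\{0,1\}$, with $Q^{(h)}_{(1)}\le\dots\le Q^{(h)}_{(n)}$ the order statistics and fixed $\gamma_0\in(0,1)$, \[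 \mathrm{HC}^{(h)}_n=\max_{1\le i\le\gamma_0 n}\sqrt n\,\frac{i/n-Q^{(h)}_{(i)}}{\sqrt{Q^{(h)}_{(i)}(1-Q^{(h)}_{(i)})}} . \] *)

(* Defs.v *)
From HB Require Import structures.
From mathcomp Require Import all_boot all_order all_algebra.
From mathcomp Require Import all_classical all_reals all_analysis.
Set Implicit Arguments. Unset Strict Implicit. Unset Printing Implicit Defensive.
Import Order.TTheory GRing.Theory Num.Theory.
Import numFieldNormedType.Exports.
Local Open Scope classical_set_scope.
Local Open Scope ring_scope.

Definition mutually_independent {R : realType} (d : measure_display)
  (T : measurableType d) (P : probability T R) (J : finType) (X : J -> T -> R) :=
  forall B : J -> set R, (forall j, measurable (B j)) ->
    fine (P (\bigcap_(j in [set: J]) (X j @^-1` B j))) =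
    \prod_(j : J) fine (P (X j @^-1` B j)).

(* The i-th order statistic (1-based, i >= 1) of the sample Q_0, ..., Q_{n-1}. *)
Definition order_stat {R : realType} (n : nat) (Q : 'I_n -> R) (i : nat) : R :=
  nth 0 (sort <=%R [seq Q k | k <- enum 'I_n]) i.-1.

(* Higher criticism statistic; maximum over 1 <= i <= gamma0 * n, taken in
   the extended reals (-oo if the range is empty). *)
Definition HC {R : realType} (gamma0 : R) (n : nat) (Q : 'I_n -> R) : \bar R :=
  \big[Order.max/-oo%E]_(i < n.+1 | (0 < i)%N && (i%:R <= gamma0 * n%:R))
     ((Num.sqrt n%:R * (i%:R / n%:R - order_stat Q i)
        / Num.sqrt (order_stat Q i * (1 - order_stat Q i)))%:E).

Definition eps {R : realType} (beta : R) (n : nat) : R := (n%:R) `^ (- beta).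

(* Main.v *)
(** Let t be the i-th order statistic of the second sample and j the number of
    points of the first sample up to t. Since x -> (a - x) / sqrt (x (1 - x)) is
    decreasing, the i-th term of HC^(1) exceeds the min(i,j)-th term of HC^(0)
    by at most (i - j) / sqrt (n t (1 - t)), and i - j is at most the number M(t)
    of contaminated points up to t. So it suffices that, with probability
    tending to 1, sqrt n (M(t) / n) / sqrt t is small uniformly in t: by the
    tail condition E M(n^-q) <= n^((1-q)/2 - eta) for some eta > 0, and Markov's inequality on
    a finite grid of exponents q of mesh at most eta gives this down to
    t = n^(-1 + 1/K), below which there is no contaminated point but there is a
    point of the first sample. A value t near 1 does no harm, since there the
    first sample already has more than gamma0 n points by Chebyshev's
    inequality. *)

Require Import Defs.
From HB Require Import structures.
From mathcomp Require Import all_boot all_order all_algebra.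
From mathcomp Require Import all_classical all_reals all_analysis.
From mathcomp Require Import measurable_realfun ring lra.
Set Implicit Arguments.
Unset Strict Implicit.
Unset Printing Implicit Defensive.
Import Order.TTheory GRing.Theory Num.Theory.
Import numFieldNormedType.Exports.
Local Open Scope classical_set_scope.
Local Open Scope ring_scope.

(** * Order statistics and a pointwise comparison of two higher criticism statistics *)

(** In a sorted list the entries at most t form a prefix, whose length is the count. The bounds on
    [i] keep the index inside the list, away from the default 0 of [nth]. All later arguments
    replace order statistics by counts through this equivalence. *)
Lemma order_stat_le (R : realType) (n : nat) (Q : 'I_n -> R) (i : nat) (t : R) :
  (0 < i <= n)%N -> (order_stat Q i <= t) = (i <= #|[pred k | (Q k <= t)%R]|)%N.
Proof.
move=> /andP[i0 lein]; rewrite /order_stat; set s := sort _ _.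
have ss : sorted <=%O s by exact: sort_le_sorted.
have szs : size s = n by rewrite size_sort size_map size_enum_ord.
have -> : #|[pred k | Q k <= t]| = count (<= t) s.
  by rewrite count_sort count_map enumT cardE /enum_mem size_filter.
have [lt_ic|le_ci] := leqP i (count (<= t) s).
  by apply: nth_count_le => //; rewrite prednK.
apply/negbTE; rewrite -ltNge; apply: (nth_count_gt _ ss).
by rewrite szs prednK// lein andbT -ltnS prednK.
Qed.

Lemma order_stat_itv (R : realType) (n : nat) (Q : 'I_n -> R) (i : nat) :
  (forall k, 0 < Q k < 1) -> (0 < i <= n)%N -> 0 < order_stat Q i < 1.
Proof.
move=> Q01 /andP[i0 lein]; rewrite /order_stat; set s := sort _ _.
have : nth 0 s i.-1 \in s.
  by rewrite mem_nth// size_sort size_map size_enum_ord prednK.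
by rewrite mem_sort => /mapP[k _ ->]; exact: Q01.
Qed.

(* With u = sqrt x and v = sqrt (1 - x), the ratio is a v / u - (1 - a) u / v. *)
Lemma standardized_gap_decr (R : realType) (a x y : R) :
  0 <= a <= 1 -> 0 < x -> x <= y -> y < 1 ->
  (a - y) / Num.sqrt (y * (1 - y)) <= (a - x) / Num.sqrt (x * (1 - x)).
Proof.
move=> /andP[a0 a1] x0 xy y1.
have y0 := lt_le_trans x0 xy; have x1 := le_lt_trans xy y1.
have gapE z : 0 < z -> z < 1 -> (a - z) / Num.sqrt (z * (1 - z)) =
    a * (Num.sqrt (1 - z) / Num.sqrt z) - (1 - a) * (Num.sqrt z / Num.sqrt (1 - z)).
  move=> z0 z1; rewrite sqrtrM ?ltW//.
  have zE := sqr_sqrtr (ltW z0).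
  have cE : Num.sqrt (1 - z) ^+ 2 = 1 - z by rewrite sqr_sqrtr// subr_ge0 ltW.
  have u0 : 0 < Num.sqrt z by rewrite sqrtr_gt0.
  have v0 : 0 < Num.sqrt (1 - z) by rewrite sqrtr_gt0 subr_gt0.
  have -> : a - z = a * Num.sqrt (1 - z) ^+ 2 - (1 - a) * Num.sqrt z ^+ 2.
    by rewrite zE cE; ring.
  by field; rewrite !gt_eqF.
rewrite !gapE//; apply: lerB; apply: ler_wpM2l; rewrite ?subr_ge0//.
- apply: ler_pM; rewrite ?invr_ge0 ?sqrtr_ge0//.
    by rewrite ler_wsqrtr// lerB.
  by rewrite lef_pV2 ?posrE ?sqrtr_gt0// ler_wsqrtr.
- apply: ler_pM; rewrite ?invr_ge0 ?sqrtr_ge0//; first by rewrite ler_wsqrtr.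
  by rewrite lef_pV2 ?posrE ?sqrtr_gt0 ?subr_gt0// ler_wsqrtr// lerB.
Qed.

(** Only t equal to an order statistic of [Q'] matters. The i-th term for [Q'] is compared with the
    j-th term for [Q], where j = min(i, N). The first two alternatives force j = i, since i <= N'
    and i <= gamma0 n; the third bounds i - j by N' - N and keeps j positive, as the maximum starts
    at index 1. *)
Lemma HC_le_add (R : realType) (n : nat) (Q Q' : 'I_n -> R) (gamma0 c : R) :
  (forall k, 0 < Q k < 1) -> (forall k, 0 < Q' k < 1) -> 0 <= c ->
  (forall t, 0 < t < 1 ->
     let N := #|[pred k | Q k <= t]| in
     let N' := #|[pred k | Q' k <= t]| in
     [\/ (N' <= N)%N, gamma0 * n%:R <= N%:R |
         (0 < N)%N /\ N'%:R - N%:R <= c * (Num.sqrt n%:R * Num.sqrt (t * (1 - t)))]) ->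
  (HC gamma0 Q' <= HC gamma0 Q + c%:E)%E.
Proof.
move=> Q01 Q'01 c0 HN; apply: bigmax_le; first exact: leNye.
move=> i /andP[i0 ig].
have i0n : (0 < i <= n)%N by rewrite i0 -ltnS ltn_ord.
have n0 : 0 < n%:R :> R by rewrite ltr0n (leq_trans i0)//; case/andP: i0n.
set t := order_stat Q' i.
have t01 : 0 < t < 1 by exact: order_stat_itv.
have iN' : (i <= #|[pred k | (Q' k <= t)%R]|)%N by rewrite -order_stat_le.
set j := minn i #|[pred k | Q k <= t]|.
have sn0 : 0 < Num.sqrt n%:R :> R by rewrite sqrtr_gt0.
have st0 : 0 < Num.sqrt (t * (1 - t)).
  by rewrite sqrtr_gt0; case/andP: t01 => ? ?; rewrite mulr_gt0// subr_gt0.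
have [j0 jd] : (0 < j)%N /\
    i%:R - j%:R <= c * (Num.sqrt n%:R * Num.sqrt (t * (1 - t))) :> R.
  have rhs0 : 0 <= c * (Num.sqrt n%:R * Num.sqrt (t * (1 - t))).
    by rewrite !mulr_ge0 ?sqrtr_ge0.
  rewrite /j; case: (leqP i #|[pred k | Q k <= t]|) => [_|Ni].
    by rewrite subrr.
  case: (HN t t01) => [NN|gN|[N0 dN]].
  - by move: (leq_trans iN' NN); rewrite leqNgt Ni.
  - by move: (le_trans ig gN); rewrite ler_nat leqNgt Ni.
  - split=> //; apply: le_trans dN; rewrite lerB// ler_nat//.
have jle : (j <= i)%N by rewrite geq_minl.
have jn : (0 < j <= n)%N by rewrite j0 (leq_trans jle)//; case/andP: i0n.
have jt : order_stat Q j <= t by rewrite order_stat_le// geq_minr.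
have /andP[qj0 qj1] := order_stat_itv Q01 jn.
have jord : (j < n.+1)%N by case/andP: jn.
pose p (k : 'I_n.+1) := (0 < k)%N && (k%:R <= gamma0 * n%:R).
have cond : p (Ordinal jord).
  by rewrite /p/= j0/= (le_trans _ ig)// ler_nat.
have := le_bigmax_cond (-oo%E : \bar R) (fun i : 'I_n.+1 =>
  (Num.sqrt n%:R * (i%:R / n%:R - order_stat Q i)
        / Num.sqrt (order_stat Q i * (1 - order_stat Q i)))%:E) cond.
rewrite -[X in (_ <= X)%E]/(HC gamma0 Q) => jHC.
apply: le_trans (leeD2r _ jHC); rewrite -EFinD lee_fin /=.
have jn1 : 0 <= (j%:R / n%:R : R) <= 1.
  by rewrite divr_ge0//= ler_pdivrMr// mul1r ler_nat; case/andP: jn.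
(* With a = j/n this moves the j-th order statistic of [Q] up to t. Both terms then have the same
   denominator, and only (i - j)/n is left in the numerator. *)
have mono := standardized_gap_decr jn1 qj0 jt (proj2 (andP t01)).
rewrite -/t -2!mulrA.
apply: le_trans (lerD (ler_wpM2l (ltW sn0) mono) (lexx c)).
rewrite -lerBlDl -mulrBr -mulrBl opprB addrA subrK -mulrBl.
rewrite mulrA ler_pdivrMr//.
have -> : n%:R = Num.sqrt n%:R ^+ 2 :> R by rewrite sqr_sqrtr// ltW.
rewrite (_ : _ * _ = (i%:R - j%:R) / Num.sqrt n%:R); last first.
  by rewrite sqrtr_sqr ger0_norm ?sqrtr_ge0//; field; rewrite gt_eqF.
by rewrite ler_pdivrMr// -mulrA [_ * Num.sqrt n%:R]mulrC.
Qed.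

(** * Counts as sums of indicators, and measurability of the statistic *)

Lemma card_indicE (R : realType) (n : nat) (T : Type) (p : 'I_n -> T -> bool) (w : T) :
  #|[pred k | p k w]|%:R = \sum_k \1_[set w' | p k w'] w :> R.
Proof.
rewrite -sum1_card natr_sum big_mkcond/=; apply: eq_bigr => k _.
by rewrite inE indicE; case: (boolP (p k w)) => pk; [rewrite mem_set|rewrite memNset//; exact/negP].
Qed.

Section measurability.
Context (R : realType) (d : measure_display) (T : measurableType d).

Lemma measurable_card (n : nat) (p : 'I_n -> T -> bool) :
  (forall k, measurable [set w | p k w]) ->
  measurable_fun setT (fun w => #|[pred k | p k w]|%:R : R).
Proof.
move=> mp; under eq_fun do rewrite card_indicE.
by apply: measurable_sum => k; exact: measurable_indic.
Qed.

Lemma measurable_fun_le_cst (X : T -> R) :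
  (forall t, measurable [set w | X w <= t]) -> measurable_fun setT X.
Proof.
move=> mX; apply: (measurability _ (RGenOInfty.measurableE R)) => _ [_ [x ->] <-].
rewrite setTI (_ : _ @^-1` _ = ~` [set w | X w <= x]); first exact: measurableC.
apply/seteqP; split=> w /=; rewrite in_itv/= andbT ltNge => /negP//.
Qed.

Lemma measurable_order_stat (n : nat) (Q : 'I_n -> T -> R) (i : nat) :
  (0 < i <= n)%N -> (forall k, measurable_fun setT (Q k)) ->
  measurable_fun setT (fun w => order_stat (Q ^~ w) i).
Proof.
move=> i0n mQ; apply: measurable_fun_le_cst => t.
under eq_set do rewrite order_stat_le// -(ler_nat R).
rewrite -[X in measurable X]setTI; apply: measurable_fun_le => //.
apply: measurable_card => k.
by rewrite -[X in measurable X]setTI; exact: measurable_fun_le.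
Qed.

Lemma measurable_bigmaxe (I : Type) (s : seq I) (p : pred I) (F : I -> T -> \bar R) :
  (forall i, p i -> measurable_fun setT (F i)) ->
  measurable_fun setT (fun w => \big[Order.max/-oo%E]_(i <- s | p i) F i w).
Proof.
move=> mF; elim: s => [|i s ih].
  by under eq_fun do rewrite big_nil; exact: measurable_cst.
case: (boolP (p i)) => pi; last by under eq_fun do rewrite big_cons (negbTE pi).
under eq_fun do rewrite big_cons pi.
by apply: measurable_maxe => //; exact: mF.
Qed.

Lemma measurable_HC (n : nat) (Q : 'I_n -> T -> R) (gamma0 : R) :
  (forall k, measurable_fun setT (Q k)) ->
  measurable_fun setT (fun w => HC gamma0 (Q ^~ w)).
Proof.
move=> mQ; apply: measurable_bigmaxe => i /andP[i0 _].
have mo : measurable_fun setT (fun w => order_stat (Q ^~ w) i).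
  by apply: measurable_order_stat => //; rewrite i0 -ltnS ltn_ord.
apply/measurable_EFinP; apply: measurable_funM.
  by apply: measurable_funM => //; exact: measurable_funB.
(* The inverse of a nonnegative number is its power with exponent -1, so measurability of [powR]
   applies. *)
have -> : (fun w => (Num.sqrt (order_stat (Q ^~ w) i * (1 - order_stat (Q ^~ w) i)))^-1)
  = (@powR R ^~ (-1)) \o Num.sqrt \o
    (fun w => order_stat (Q ^~ w) i * (1 - order_stat (Q ^~ w) i)).
  by apply/funext => w /=; rewrite powR_inv1 ?sqrtr_ge0.
apply: measurableT_comp; last by apply: measurable_funM => //; exact: measurable_funB.
apply: measurableT_comp; first exact: measurable_powR.
by apply: nondecreasing_measurable => // x y xy; exact: ler_wsqrtr.
Qed.

End measurability.

(** * Union bound, Markov's and Chebyshev's inequalities, pairwise independence *)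

Section probability_bounds.
Context (R : realType) (d : measure_display) (T : measurableType d).
Context (P : probability T R).

(* The union bound, Markov's and Chebyshev's inequalities are all the
   expectation of a pointwise inequality between combinations of indicators. *)
Lemma sum_prob_ge0 (J : finType) (b : J -> R) (B : J -> set T) :
  (forall j, measurable (B j)) ->
  (forall w, 0 <= \sum_j b j * \1_(B j) w) ->
  0 <= \sum_j b j * fine (P (B j)).
Proof.
move=> mB b0.
have intB j : P.-integrable setT (fun w => (b j * \1_(B j) w)%:E).
  under eq_fun do rewrite EFinM.
  by apply: integrableZl => //; apply: integrable_indic.
have : (0 <= \int[P]_w (\sum_j b j * \1_(B j) w)%:E)%E.
  by apply: integral_ge0 => w _; rewrite lee_fin.
under eq_integral do rewrite -sumEFin.
rewrite integral_sum// -lee_fin -sumEFin => /le_trans; apply.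
apply: lee_sum => j _; under eq_integral do rewrite EFinM.
rewrite integralZl//; last exact: integrable_indic.
by rewrite integral_indic// setIT EFinM fineK// fin_num_measure.
Qed.

(** Expectation of 1_A <= sum_j 1_(B_j); the additional index from ['I_1] carries A with coefficient
    -1. *)
Lemma prob_exists_le (J : finType) (A : set T) (B : J -> set T) :
  measurable A -> (forall j, measurable (B j)) ->
  (forall w, A w -> exists j, B j w) ->
  fine (P A) <= \sum_j fine (P (B j)).
Proof.
move=> mA mB AB.
pose B' (j : 'I_1 + J) := if j is inr j' then B j' else A.
pose b (j : 'I_1 + J) : R := if j is inr _ then 1 else -1.
have := @sum_prob_ge0 ('I_1 + J)%type b B'.
rewrite big_sumType big_ord1/= mulN1r; under eq_bigr do rewrite mul1r.
rewrite addrC subr_ge0; apply; first by case.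
move=> w; rewrite big_sumType big_ord1/= mulN1r; under eq_bigr do rewrite mul1r.
rewrite addrC subr_ge0 [leLHS]indicE; case: (asboolP (A w)) => Aw.
  have [j Bj] := AB _ Aw; rewrite mem_set// (bigD1 j)//= indicE mem_set//.
  by rewrite lerDl sumr_ge0// => i _; rewrite indicE.
by rewrite memNset// sumr_ge0// => i _; rewrite indicE.
Qed.

(** Markov's inequality: with N the count, a 1_(N > a) <= N pointwise. *)
Lemma prob_card_gt (n : nat) (p : 'I_n -> T -> bool) (a : R) :
  (forall k, measurable [set w | p k w]) -> 0 < a ->
  fine (P [set w | a < #|[pred k | p k w]|%:R]) <=
  (\sum_k fine (P [set w | p k w])) / a.
Proof.
move=> mp a0; rewrite ler_pdivlMr// mulrC.
set A := [set w | a < _].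
have mA : measurable A.
  rewrite /A (_ : [set _ | _] = ~` [set w | #|[pred k | p k w]|%:R <= a]).
    apply: measurableC; rewrite -[X in measurable X]setTI.
    by apply: measurable_fun_le => //; exact: measurable_card.
  by apply/seteqP; split=> w /=; rewrite ltNge => /negP.
pose B' (j : 'I_1 + 'I_n) := if j is inr j' then [set w | p j' w] else A.
pose b (j : 'I_1 + 'I_n) : R := if j is inr _ then 1 else -a.
have := @sum_prob_ge0 ('I_1 + 'I_n)%type b B'.
rewrite big_sumType big_ord1/= mulNr; under eq_bigr do rewrite mul1r.
rewrite addrC subr_ge0; apply; first by case.
move=> w; rewrite big_sumType big_ord1/= mulNr; under eq_bigr do rewrite mul1r.
rewrite addrC subr_ge0 -card_indicE indicE; case: (asboolP (A w)) => Aw.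
  by rewrite mem_set// mulr1 ltW.
by rewrite memNset// mulr0.
Qed.

(** Chebyshev's inequality under pairwise independence. With N the count, (ns - m)^2 1_(N < m) <=
    (ns - N)^2 pointwise; the square is expanded, N^2 being a sum over ordered pairs of indices, and
    expectations are taken term by term. *)
Lemma prob_card_lt (n : nat) (p : 'I_n -> T -> bool) (s m : R) :
  (forall k, measurable [set w | p k w]) ->
  (forall k, fine (P [set w | p k w]) = s) ->
  (forall j k, j != k -> fine (P ([set w | p j w] `&` [set w | p k w])) = s * s) ->
  m < n%:R * s ->
  fine (P [set w | #|[pred k | p k w]|%:R < m]) <=
  n%:R * s / (n%:R * s - m) ^+ 2.
Proof.
move=> mp Ps Pss ms; rewrite ler_pdivlMr ?exprn_gt0 ?subr_gt0// mulrC.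
set A := [set w | _ < m].
have mA : measurable A.
  rewrite /A (_ : [set _ | _] = ~` [set w | m <= #|[pred k | p k w]|%:R]).
    apply: measurableC; rewrite -[X in measurable X]setTI.
    by apply: measurable_fun_le => //; exact: measurable_card.
  by apply/seteqP; split=> w /=; rewrite ltNge => /negP.
pose p' k := [set w | p k w].
pose B' (j : bool + ('I_n + 'I_n * 'I_n)) : set T := match j with
  | inl true => A | inl false => setT
  | inr (inl k) => p' k | inr (inr jk) => p' jk.1 `&` p' jk.2 end.
pose b (j : bool + ('I_n + 'I_n * 'I_n)) : R := match j with
  | inl true => - (n%:R * s - m) ^+ 2 | inl false => (n%:R * s) ^+ 2
  | inr (inl k) => - (2 * n%:R * s) | inr (inr jk) => 1 end.
have sumE (F : set T -> R) : \sum_j b j * F (B' j) =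
    - (n%:R * s - m) ^+ 2 * F A + (n%:R * s) ^+ 2 * F setT
    - 2 * n%:R * s * \sum_k F (p' k) + \sum_j \sum_k F (p' j `&` p' k).
  rewrite !big_sumType big_bool/= -!addrA; congr (_ + (_ + (_ + _))).
    by rewrite -mulr_sumr mulNr.
  by rewrite pair_bigA; apply: eq_bigr => j _; rewrite mul1r.
have := @sum_prob_ge0 _ b B'.
rewrite (sumE (fun A => fine (P A))).
have -> : \sum_k fine (P (p' k)) = n%:R * s.
  by under eq_bigr do rewrite Ps; rewrite sumr_const card_ord mulr_natl.
have -> : \sum_j \sum_k fine (P (p' j `&` p' k)) = n%:R * (s + (n%:R - 1) * (s * s)).
  transitivity (\sum_(j < n) (s + (n%:R - 1) * (s * s))); last first.
    by rewrite sumr_const card_ord mulr_natl.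
  apply: eq_bigr => j _; rewrite (bigD1 j)//= setIid Ps; congr (_ + _).
  rewrite (eq_bigr (fun=> s * s)); last by move=> k kj; rewrite Pss// eq_sym.
  rewrite sumr_const -[LHS]mulr_natl; congr (_ * _).
  have := cardC1 j; rewrite card_ord => ->.
  by rewrite -subn1 natrB// (leq_trans _ (ltn_ord j)).
have -> : fine (P setT) = 1 by rewrite probability_setT.
(* The expectation of (ns - N)^2 is the variance ns - ns^2, of which only ns is kept in the final
   bound. *)
move=> H; suff : 0 <= n%:R * s - (n%:R * s - m) ^+ 2 * fine (P A) - n%:R * s ^+ 2.
  have : 0 <= n%:R * s ^+ 2 by rewrite mulr_ge0// sqr_ge0.
  lra.
have -> : n%:R * s - (n%:R * s - m) ^+ 2 * fine (P A) - n%:R * s ^+ 2 =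
  - (n%:R * s - m) ^+ 2 * fine (P A) + (n%:R * s) ^+ 2 * 1
    - 2 * n%:R * s * (n%:R * s) + n%:R * (s + (n%:R - 1) * (s * s)) by ring.
apply: H.
  by move=> [[]|[k|[j k]]] //=; [exact: mp|apply: measurableI; exact: mp].
move=> w; rewrite (sumE (fun A => \1_A w)) -card_indicE.
set N := #|_|%:R.
have -> : \sum_j \sum_k (\1_(p' j `&` p' k) w : R) = N * N.
  rewrite /N card_indicE big_distrl/=; apply: eq_bigr => j _.
  rewrite big_distrr/=; apply: eq_bigr => k _.
  by rewrite -/(p' j) -/(p' k) !indicE in_setI -natrM mulnb.
rewrite [\1_setT w]indicE in_setT mulr1 indicE.
have sq : 0 <= (n%:R * s - N) ^+ 2 by exact: sqr_ge0.
case: (asboolP (A w)) => Aw; last by rewrite memNset// mulr0; nra.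
rewrite mem_set// mulr1; move: Aw; rewrite /A/= -/N => Nm; nra.
Qed.

(** The product formula is applied to sets equal to the whole line at all indices other than j and
    k, which contribute factors 1. *)
Lemma mutually_independent2 (J : finType) (X : J -> T -> R) (j k : J) (A B : set R) :
  mutually_independent P X -> j != k -> measurable A -> measurable B ->
  fine (P (X j @^-1` A `&` X k @^-1` B)) =
  fine (P (X j @^-1` A)) * fine (P (X k @^-1` B)).
Proof.
move=> indX jk mA mB.
pose S i := if i == j then A else if i == k then B else setT.
have Sj : S j = A by rewrite /S eqxx.
have Sk : S k = B by rewrite /S eqxx eq_sym (negbTE jk).
have mS i : measurable (S i) by rewrite /S; case: ifP => // _; case: ifP.
have := indX S mS.
have -> : \bigcap_(i in [set: J]) (X i @^-1` S i) = X j @^-1` A `&` X k @^-1` B.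
  apply/seteqP; split=> w.
    by move=> H; split; [rewrite -Sj|rewrite -Sk]; exact: H.
  by move=> [Aw Bw] i _; rewrite /S /preimage/=; case: eqP => [->//|_]; case: eqP => [->|].
move=> ->; rewrite (bigD1 j)//= (bigD1 k) ?(eq_sym k)//= Sj Sk big1 ?mulr1//.
move=> i /andP[/negbTE ij /negbTE ik].
by rewrite /S ij ik preimage_setT probability_setT.
Qed.

End probability_bounds.

(** * Deterministic comparison along a grid *)

(** A discrete intermediate value argument: descending from m, stop at the first index where [s]
    exceeds t. *)
Lemma exists_grid_step (R : realType) (s : nat -> R) (t : R) (m : nat) :
  t < s 0 -> s m <= t -> exists2 k, (k < m)%N & s k.+1 <= t < s k.
Proof.
move=> t0; elim: m => [|m ih] smt; first by move: (lt_le_trans t0 smt); rewrite ltxx.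
have [/ih[k km tk]|tm] := leP (s m) t; first by exists k => //; exact: ltnW.
by exists m => //; rewrite smt.
Qed.

(** The three alternatives of [HC_le_add] correspond to three ranges of t. Below [s m] there is no
    contaminated point; from [gamma1] on, the sample [Q] already has enough points; in between, s
    (k+1) <= t < s k for some k, so the contaminated count is bounded by that at [s k], while sqrt t
    >= sqrt (s (k+1)) and 1 - t >= 1 - gamma1. *)
Lemma HC_mixture_le (R : realType) (n : nat) (Q Y : 'I_n -> R) (b : pred 'I_n)
    (gamma0 gamma1 c : R) (s : nat -> R) (m : nat) :
  0 <= c -> (forall k, 0 < Q k < 1) -> (forall k, 0 < Y k < 1) ->
  gamma1 < 1 -> 1 <= s 0 -> (forall k, 0 < s k) ->
  gamma0 * n%:R <= #|[pred k | Q k <= gamma1]|%:R ->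
  (0 < #|[pred k | (Q k <= s m)%R]|)%N ->
  #|[pred k | b k && (Y k < s m)]| = 0 ->
  (forall k, (k < m)%N -> #|[pred i | b i && (Y i < s k)]|%:R <=
     c * Num.sqrt (1 - gamma1) * (Num.sqrt n%:R * Num.sqrt (s k.+1))) ->
  (HC gamma0 (fun i => if b i then Y i else Q i) <= HC gamma0 Q + c%:E)%E.
Proof.
move=> c0 Q01 Y01 g1 s0 sgt0 HLLN Hmin Hnone Hgrid; apply: HC_le_add => // [k|t].
  by case: ifP.
move=> /andP[t0 t1] N N'.
(* A point of the mixture up to t is either a point of [Q] or a contaminated point of [Y]. *)
have cardM : (N' <= N + #|[pred i | b i && (Y i <= t)%R]|)%N.
  rewrite -cardUI; apply: (leq_trans _ (leq_addr _ _)).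
  apply/subset_leq_card/fintype.subsetP => i; rewrite !inE.
  by case: ifP => _ ->; rewrite ?orbT.
have cardMs x : t < x -> (N' <= N + #|[pred i | b i && (Y i < x)%R]|)%N.
  move=> tx; apply: (leq_trans cardM); rewrite leq_add2l.
  apply/subset_leq_card/fintype.subsetP => i; rewrite !inE => /andP[-> /=] yt.
  exact: le_lt_trans tx.
have cardQ x : x <= t -> (#|[pred k | (Q k <= x)%R]| <= N)%N.
  move=> xt; apply/subset_leq_card/fintype.subsetP => i; rewrite !inE => Qx.
  exact: le_trans xt.
have [smt|tsm] := leP (s m) t; last first.
  by apply: Or31; have := cardMs _ tsm; rewrite Hnone addn0.
have [g1t|tg1] := leP gamma1 t.
  by apply: Or32; apply: le_trans HLLN _; rewrite ler_nat; exact: cardQ.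
have [k km /andP[skt tsk]] := exists_grid_step (lt_le_trans t1 s0) smt.
apply: Or33; split; first exact: leq_trans (cardQ _ smt).
rewrite lerBlDl; apply: (@le_trans _ _ (N + #|[pred i | b i && (Y i < s k)%R]|)%:R).
  by rewrite ler_nat; exact: cardMs.
rewrite natrD lerD2l; apply: le_trans (Hgrid k km) _.
rewrite (sqrtrM _ (ltW t0)) -mulrA ler_wpM2l// mulrCA ler_wpM2l ?sqrtr_ge0//.
by rewrite mulrC ler_pM ?sqrtr_ge0// ler_wsqrtr// lerB// ltW.
Qed.

(** * Powers of n, the tail condition, and counts of uniform variables *)

Lemma powR_natN_cvg0 (R : realType) (a : R) : 0 < a ->
  (n%:R : R) `^ (- a) @[n --> \oo] --> (0 : R).
Proof.
move=> a0; apply/cvgrPdist_le => e e0.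
near=> n; rewrite sub0r normrN ger0_norm ?powR_ge0//.
have en : e `^ (- a^-1) <= n%:R by near: n; exact: nbhs_infty_ger.
have eE : (e `^ (- a^-1)) `^ a = e^-1.
  by rewrite -powRrM mulNr mulVf ?gt_eqF// powR_inv1// ltW.
have ena : e^-1 <= n%:R `^ a.
  by rewrite -eE; apply: ge0_ler_powR; rewrite ?nnegrE ?powR_ge0// ltW.
rewrite powRN -[leRHS]invrK lef_pV2// posrE ?invr_gt0//.
by apply: lt_le_trans ena; rewrite invr_gt0.
Unshelve. all: by end_near. Qed.

(** The lower half of the absolute value bound gives ln p <= (delta - a) ln x, to be
    exponentiated. *)
Lemma tail_le_powR (R : realType) (x p a delta : R) : 1 < x -> 0 < p ->
  `| - ln p - a * ln x | <= delta * ln x -> p <= x `^ (delta - a).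
Proof.
move=> x1 p0; rewrite ler_norml => /andP[H _].
have x0 : 0 < x by apply: lt_trans x1.
by rewrite -ler_ln ?posrE ?powR_gt0// ln_powR; lra.
Qed.

(** Chebyshev's inequality for the uniform empirical distribution function, later used both at the
    bottom of the grid and at a fixed level near 1. *)
Lemma card_uniform_lt (R : realType) (d : measure_display) (T : measurableType d)
    (P : probability T R) (n : nat) (Q : 'I_n -> T -> R) (s m : R) :
  (forall i, measurable_fun setT (Q i)) ->
  (forall i (B : set R), measurable B ->
     P (Q i @^-1` B) = lebesgue_measure (B `&` `]0%R, 1%R[)) ->
  (forall i j (A B : set R), i != j -> measurable A -> measurable B ->
     fine (P (Q i @^-1` A `&` Q j @^-1` B)) =
     fine (P (Q i @^-1` A)) * fine (P (Q j @^-1` B))) ->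
  0 < s < 1 -> m < n%:R * s ->
  fine (P [set w | #|[pred k | Q k w <= s]|%:R < m]) <=
  n%:R * s / (n%:R * s - m) ^+ 2.
Proof.
move=> mQ PQ indep /andP[s0 s1] ms.
have pre k : [set w | Q k w <= s] = Q k @^-1` `]-oo, s].
  by apply/seteqP; split=> w /=; rewrite in_itv.
have Qs k : fine (P (Q k @^-1` `]-oo, s])) = s.
  rewrite PQ// (_ : _ `&` _ = `]0, s]%classic).
    by rewrite lebesgue_measure_itv/= lte_fin s0 oppr0 adde0.
  apply/seteqP; split=> x /=; rewrite !in_itv/=; first by move=> [-> /andP[-> _]].
  by move=> /andP[x0 xs]; rewrite xs x0 (le_lt_trans xs).
apply: prob_card_lt => [k|k|j k jk|//].
- rewrite pre -[X in measurable X]setTI; exact: mQ.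
- by rewrite pre.
- by rewrite !pre indep// !Qs.
Qed.

(** * The coupling: measurability, and a union bound over the bad events *)

Section coupling.
Context (R : realType) (d : measure_display) (T : measurableType d).
Context (P : probability T R) (n : nat) (Ind Q0 Y : 'I_n -> T -> R).
Context (mInd : forall i, measurable_fun setT (Ind i))
  (mQ0 : forall i, measurable_fun setT (Q0 i))
  (mY : forall i, measurable_fun setT (Y i)).

Lemma measurable_contaminated (i : 'I_n) (x : R) :
  measurable [set w | (Ind i w == 1) && (Y i w < x)].
Proof.
rewrite (_ : [set _ | _] = Ind i @^-1` [set 1] `&` Y i @^-1` `]-oo, x[).
  by apply: measurableI; rewrite -[X in measurable X]setTI; [exact: mInd|exact: mY].
apply/seteqP; split=> w /=; rewrite in_itv/=.
  by move=> /andP[/eqP-> ->].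
by move=> [-> ->]; rewrite eqxx.
Qed.

Lemma measurable_HC_gt (gamma0 c : R) :
  measurable [set w |
    (HC gamma0 (fun i => if Ind i w == 1%R then Y i w else Q0 i w)
      > HC gamma0 (fun i => Q0 i w) + c%:E)%E].
Proof.
rewrite -[X in measurable X]setTI; apply: measurable_lte => //.
  by apply: emeasurable_funD => //; apply: (@measurable_HC _ _ _ _ Q0).
apply: (@measurable_HC _ _ _ _ (fun i w => if Ind i w == 1%R then Y i w else Q0 i w)) => i.
apply: measurable_fun_ifT => //.
by apply: measurable_fun_eqr.
Qed.

(** Outside the events on the right and the null events, the hypotheses of [HC_mixture_le] hold. The
    sum includes k = m because there the threshold is below 1, so a count not exceeding it vanishes:
    no contaminated point lies below [s m]. *)
Lemma HC_gt_prob_le (gamma0 gamma1 c c' : R) (s : nat -> R) (m : nat) (a : R) :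
  0 <= c -> gamma1 < 1 -> 1 <= s 0 -> (forall k, 0 < s k) -> 0 < a ->
  c' <= c * Num.sqrt (1 - gamma1) -> c' * (Num.sqrt n%:R * Num.sqrt (s m.+1)) < 1 ->
  (forall i, P (Q0 i @^-1` (~` `]0%R, 1%R[)) = 0%E) ->
  (forall i, P (Y i @^-1` (~` `]0%R, 1%R[)) = 0%E) ->
  fine (P [set w |
    (HC gamma0 (fun i => if Ind i w == 1%R then Y i w else Q0 i w)
      > HC gamma0 (fun i => Q0 i w) + c%:E)%E]) <=
  \sum_(k < m.+1) fine (P [set w | c' * (Num.sqrt n%:R * Num.sqrt (s k.+1)) <
        #|[pred i | (Ind i w == 1) && (Y i w < s k)]|%:R]) +
  (fine (P [set w | #|[pred k | Q0 k w <= s m]|%:R < a]) +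
   fine (P [set w | #|[pred k | Q0 k w <= gamma1]|%:R < gamma0 * n%:R])).
Proof.
move=> c0 g1 s0 sgt0 a0 c'c c'1 Q0null Ynull.
(* The first two families are the null events that some variable leaves (0,1); listing them lets the
   deterministic comparison be applied at every remaining [w]. *)
pose B (j : ('I_n + 'I_n) + ('I_m.+1 + bool)) : set T := match j with
  | inl (inl i) => Q0 i @^-1` (~` `]0%R, 1%R[)
  | inl (inr i) => Y i @^-1` (~` `]0%R, 1%R[)
  | inr (inl k) => [set w | c' * (Num.sqrt n%:R * Num.sqrt (s k.+1)) <
        #|[pred i | (Ind i w == 1) && (Y i w < s k)]|%:R]
  | inr (inr true) => [set w | #|[pred k | Q0 k w <= s m]|%:R < a]
  | inr (inr false) => [set w | #|[pred k | Q0 k w <= gamma1]|%:R < gamma0 * n%:R]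
  end.
have mlt (X Z : T -> R) : measurable_fun setT X -> measurable_fun setT Z ->
    measurable [set w | X w < Z w].
  move=> mX mZ; rewrite (_ : [set _ | _] = ~` [set w | Z w <= X w]).
    apply: measurableC; rewrite -[A in measurable A]setTI.
    exact: measurable_fun_le.
  by apply/seteqP; split=> w /=; rewrite ltNge => /negP.
have mQle x : measurable_fun setT (fun w => #|[pred k | Q0 k w <= x]|%:R : R).
  apply: measurable_card => k; rewrite -[A in measurable A]setTI.
  exact: measurable_fun_le.
have mB j : measurable (B j).
  case: j => [[i|i]|[k|[]]] /=.
  - by rewrite -[A in measurable A]setTI; apply: mQ0 => //; exact: measurableC.
  - by rewrite -[A in measurable A]setTI; apply: mY => //; exact: measurableC.
  - apply: mlt => //; apply: measurable_card => i.
    exact: measurable_contaminated.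
  - exact: mlt.
  - exact: mlt.
apply: le_trans (@prob_exists_le _ _ _ P _ _ B (measurable_HC_gt gamma0 c) mB _) _;
  last first.
  rewrite !big_sumType big_bool/=.
  rewrite big1 ?add0r => [|i _]; last by rewrite Q0null.
  by rewrite big1 ?add0r => [//|i _]; rewrite Ynull.
move=> w; apply: contraPP => /forallNP nB /=; apply/negP; rewrite -leNgt.
have Q01 i : 0 < Q0 i w < 1.
  by have := nB (inl (inl i)); rewrite /B/= => /contrapT; rewrite in_itv.
have Y01 i : 0 < Y i w < 1.
  by have := nB (inl (inr i)); rewrite /B/= => /contrapT; rewrite in_itv.
have Hgrid k : (k <= m)%N -> #|[pred i | (Ind i w == 1) && (Y i w < s k)]|%:R <=
    c' * (Num.sqrt n%:R * Num.sqrt (s k.+1)).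
  by rewrite -ltnS => km; have := nB (inr (inl (Ordinal km))); rewrite /B/= => /negP; rewrite -leNgt.
have Hmin := nB (inr (inr true)); rewrite /B/= in Hmin.
have HLLN := nB (inr (inr false)); rewrite /B/= in HLLN.
apply: (@HC_mixture_le R n (Q0 ^~ w) (Y ^~ w) (fun i => Ind i w == 1) gamma0 gamma1 c s m)
  => //.
- by move/negP: HLLN; rewrite -leNgt.
- move/negP: Hmin; rewrite -leNgt -(ltr_nat R) => /(lt_le_trans a0) //.
- have := le_lt_trans (Hgrid m (leqnn m)) c'1.
  by rewrite -[1]/(1%:R) ltr_nat ltnS leqn0 => /eqP.
- move=> k km; apply: le_trans (Hgrid k (ltnW km)) _.
  by rewrite ler_wpM2r// mulr_ge0 ?sqrtr_ge0.
Qed.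

End coupling.

(** * Choice of grid and constants, exponent bookkeeping, and the limit *)

Theorem theorem2 (R : realType) (beta r gamma0 C : R)
  (alpha : R -> R -> R) (delta : nat -> R)
  (f : forall n : nat, 'I_n -> R -> R)
  (d : measure_display) (T : measurableType d) (P : probability T R)
  (Ind Q0 Y : forall n : nat, 'I_n -> T -> R) :
  (* parameters *)
  1 / 2 < beta < 1 -> 0 < r -> 0 < gamma0 < 1 ->
  (* alpha : [0,1] x (0,oo) -> [0,oo), continuous, monotone *)
  {within [set qr : R * R | 0 <= qr.1 <= 1 /\ 0 < qr.2],
     continuous (fun qr : R * R => alpha qr.1 qr.2)} ->
  (forall q s, 0 <= q <= 1 -> 0 < s -> 0 <= alpha q s) ->
  (forall q1 q2 s, 0 <= q1 -> q1 <= q2 -> q2 <= 1 -> 0 < s ->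
     alpha q1 s <= alpha q2 s) ->
  (forall q s1 s2, 0 <= q <= 1 -> 0 < s1 -> s1 <= s2 ->
     alpha q s2 <= alpha q s1) ->
  (* the densities f n i of G_{n,i}: continuous on (0,1), bounded by C *)
  (forall n (i : 'I_n) x, 0 <= f n i x <= C) ->
  (forall n (i : 'I_n) x, 0 < x < 1 -> {for x, continuous (f n i)}) ->
  (* G_{n,i}(t) >= t on (0,1) *)
  (forall n (i : 'I_n) (t : R), 0 < t < 1 ->
     (t%:E <= \int[lebesgue_measure]_(x in `]0%R, t]) (f n i x)%:E)%E) ->
  (* tail condition (T) *)
  (delta @ \oo --> 0) ->
  (forall n (i : 'I_n) (q : R), 0 < q <= 1 ->
     let p := (\int[lebesgue_measure]_(x in `]0%R, ((n%:R : R) `^ (- q))%R[) (f n i x)%:E)%E in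
     (0 < p)%E /\
     `| - ln (fine p) - alpha q r * ln n%:R | <= delta n * ln n%:R) ->
  (* the coupling *)
  (forall n (i : 'I_n), measurable_fun setT (Ind n i)) ->
  (forall n (i : 'I_n), measurable_fun setT (Q0 n i)) ->
  (forall n (i : 'I_n), measurable_fun setT (Y n i)) ->
  (forall n, mutually_independent P
     (fun j : ('I_n + 'I_n) + 'I_n =>
        match j with
        | inl (inl i) => Ind n i
        | inl (inr i) => Q0 n i
        | inr i => Y n i
        end)) ->
  (forall n (i : 'I_n), P (Ind n i @^-1` [set 1]) = (eps beta n)%:E) ->
  (forall n (i : 'I_n), P (Ind n i @^-1` [set 0]) = (1 - eps beta n)%:E) ->
  (forall n (i : 'I_n) (B : set R), measurable B ->
     P (Q0 n i @^-1` B) = lebesgue_measure (B `&` `]0%R, 1%R[)) ->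
  (forall n (i : 'I_n) (B : set R), measurable B ->
     P (Y n i @^-1` B) =
       (\int[lebesgue_measure]_(x in B `&` `]0%R, 1%R[) (f n i x)%:E)%E) ->
  (* separation condition: sup_{q in (0,1]} ((1+q)/2 - alpha(q,r) - beta) < 0 *)
  (exists2 eta : R, 0 < eta &
     forall q, 0 < q <= 1 -> (1 + q) / 2 - alpha q r - beta <= - eta) ->
  forall c : R, 0 < c ->
  P [set w | (HC gamma0 (fun i : 'I_n => if Ind n i w == 1%R then Y n i w else Q0 n i w)
              > HC gamma0 (fun i : 'I_n => Q0 n i w) + c%:E)%E]
    @[n --> \oo] --> 0%E.
Proof.
move=> /andP[b12 b1] r0 /andP[g0 g1] _ alpha0 _ _ _ _ _ dl0 tail mInd mQ mY.
move=> indep PI1 _ PQ PY [eta eta0 sep] c c0.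
(* At q = 0 the tail condition says nothing, and n^-beta is used instead: this is
   where beta > 1/2 enters, through the second term of the minimum. *)
pose en : R := Num.min eta (beta - 1 / 2).
have en0 : 0 < en by rewrite lt_min eta0 subr_gt0.
have en_eta : en <= eta by rewrite ge_min lexx.
have en_beta : en <= beta - 1 / 2 by rewrite ge_min lexx orbT.
(* The grid is n^(-k/K) with mesh 1/K <= [en]. Since K = m + 1, it has s_m = n^(-1 + 1/K) and
   s_(m+1) = 1/n. *)
pose m := (Num.bound en^-1).+1; pose K : R := m.+1%:R.
have K0 : 0 < K by rewrite ltr0n.
have Ken : K^-1 <= en.
  rewrite -[leRHS]invrK lef_pV2 ?posrE ?invr_gt0//.
  apply: (le_trans (ltW (archi_boundP _))); first by rewrite invr_ge0 ltW.
  by rewrite ler_nat /m -addn2 leq_addr.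
pose s n k : R := n%:R `^ (- (k%:R / K)).
(* Any level strictly between [gamma0] and 1 would do: the gap to [gamma0] serves Chebyshev, the gap
   to 1 bounds 1 - t from below. *)
pose gamma1 := (gamma0 + 1) / 2.
have g01 : gamma0 < gamma1 by rewrite /gamma1; lra.
have g11 : gamma1 < 1 by rewrite /gamma1; lra.
(* The cap 1/2 puts the threshold at k = m below 1. *)
pose c' := Num.min (c * Num.sqrt (1 - gamma1)) (1 / 2).
have c'0 : 0 < c' by rewrite lt_min divr_gt0// andbT mulr_gt0// sqrtr_gt0 subr_gt0.
have Q0null n i : P (Q0 n i @^-1` (~` `]0%R, 1%R[)) = 0%E.
  by rewrite PQ ?setICl ?measure0//; exact: measurableC.
have Ynull n i : P (Y n i @^-1` (~` `]0%R, 1%R[)) = 0%E.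
  by rewrite PY ?setICl ?integral_set0//; exact: measurableC.
(* With q = k/K, independence and the tail condition give the exponent delta - alpha - beta, which
   is at most -(1+q)/2 - eta + en/4. *)
have contaminated_le n k i : (1 < n)%N -> delta n <= en / 4 -> (k <= m)%N ->
    fine (P [set w | (Ind n i w == 1) && (Y n i w < s n k)]) <=
    n%:R `^ ((- 1 - k%:R / K) / 2 - 3 / 4 * en).
  move=> n1 dn km.
  have n1' : 1 < n%:R :> R by rewrite ltr1n.
  have n0' : 0 < n%:R :> R by apply: lt_trans n1'.
  rewrite (_ : [set _ | _] = Ind n i @^-1` [set 1] `&` Y n i @^-1` `]-oo, s n k[);
    last first.
    apply/seteqP; split=> w /=; rewrite in_itv/=; first by move=> /andP[/eqP-> ->].
    by move=> [-> ->]; rewrite eqxx.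
  have -> := @mutually_independent2 _ _ _ _ _ _ (inl (inl i)) (inr i)
    [set 1] `]-oo, s n k[ (indep n) isT (measurable_set1 _) (measurable_itv _).
  rewrite PI1/= /eps.
  have [->|k0] := eqVneq k 0.
    rewrite mul0r subr0; apply: (@le_trans _ _ (n%:R `^ (- beta))).
      apply: ler_piMr; first exact: powR_ge0.
      by rewrite -lee_fin fineK ?fin_num_measure ?probability_le1//;
        rewrite -[X in measurable X]setTI; apply: mY.
    by apply: ler_powR; [exact: ltW|lra].
  pose q : R := k%:R / K.
  have q01 : 0 < q <= 1.
    rewrite divr_gt0 ?ltr0n ?lt0n//= ler_pdivrMr// mul1r ler_nat.
    exact: leq_trans km _.
  have [p0 ptail] := tail n i q q01.
  have sE : P (Y n i @^-1` `]-oo, s n k[) =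
      (\int[lebesgue_measure]_(x in `]0%R, (n%:R `^ (- q))%R[) (f n i x)%:E)%E.
    rewrite PY//; congr (integral _ _ _); apply/seteqP; split=> x /=.
      by rewrite !in_itv/= => -[xs /andP[-> _]].
    rewrite !in_itv/= => /andP[x0 xs]; rewrite x0 xs; split=> //=.
    apply: lt_le_trans xs _; rewrite -[leRHS](powRr0 n%:R).
    by apply: ler_powR; [exact: ltW|rewrite oppr_le0; case/andP: q01 => /ltW].
  have fin_p : P (Y n i @^-1` `]-oo, s n k[) \is a fin_num.
    by rewrite fin_num_measure// -[X in measurable X]setTI; apply: mY.
  have := tail_le_powR n1' _ ptail; rewrite -sE => Hp.
  have {}Hp := Hp (fine_gt0 _).
  apply: (@le_trans _ _ (n%:R `^ (- beta) * n%:R `^ (delta n - alpha q r))).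
    apply: ler_wpM2l; first exact: powR_ge0.
    apply: Hp; rewrite sE p0 -sE ltey_eq fin_p//.
  rewrite -powRD; last by rewrite (gt_eqF n0') implybT.
  apply: ler_powR; first exact: ltW.
  have := sep q q01; rewrite -/q; lra.
(* The expected count is at most n^((1-q)/2 - 3 en/4) with q = k/K, and the threshold is c' n^((1 -
   q - 1/K)/2). One grid step costs 1/(2K) <= en/2 in the exponent, which leaves en/4. *)
have grid_prob n k : (1 < n)%N -> delta n <= en / 4 -> (k <= m)%N ->
    fine (P [set w | c' * (Num.sqrt n%:R * Num.sqrt (s n k.+1)) <
        #|[pred i | (Ind n i w == 1) && (Y n i w < s n k)]|%:R]) <=
    n%:R `^ (- (en / 4)) / c'.
  move=> n1 dn km.
  have n1' : 1 < n%:R :> R by rewrite ltr1n.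
  have n0' : 0 < n%:R :> R by apply: lt_trans n1'.
  have sn0 : 0 < Num.sqrt n%:R * Num.sqrt (s n k.+1).
    by rewrite mulr_gt0// sqrtr_gt0// powR_gt0.
  apply: le_trans (prob_card_gt _ _ _) _.
  - by move=> i; apply: measurable_contaminated.
  - by rewrite mulr_gt0.
  rewrite ler_pdivrMr; last exact: mulr_gt0.
  rewrite mulrA divfK ?gt_eqF//.
  apply: (@le_trans _ _ (\sum_(i < n) n%:R `^ ((- 1 - k%:R / K) / 2 - 3 / 4 * en))).
    by apply: ler_sum => i _; exact: contaminated_le.
  rewrite sumr_const card_ord -[leLHS]mulr_natl.
  rewrite -(powR12_sqrt (ltW n0')) -(powR12_sqrt (powR_ge0 _ _)) -powRrM.
  have nz (x y : R) : (x + y == 0) ==> (n%:R != 0 :> R) by rewrite (gt_eqF n0') implybT.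
  rewrite -{1}[n%:R](powRr1 (ltW n0')) -!powRD//.
  apply: ler_powR; first exact: ltW.
  have -> : k.+1%:R / K = k%:R / K + K^-1 by rewrite -addn1 natrD mulrDl mul1r.
  by move: (k%:R / K) (K^-1) Ken => q v Ken; lra.
have mK : (m%:R / K) = 1 - K^-1.
  by rewrite -[m%:R](addrK 1) natr1 mulrBl divff ?gt_eqF// mul1r.
have indepQ n i j (A B : set R) : i != j -> measurable A -> measurable B ->
     fine (P (Q0 n i @^-1` A `&` Q0 n j @^-1` B)) =
     fine (P (Q0 n i @^-1` A)) * fine (P (Q0 n j @^-1` B)).
  move=> ij mA mB.
  exact: (@mutually_independent2 _ _ _ _ _ _ (inl (inr i)) (inl (inr j)) A B (indep n)).
(* Here the mean is x = n s_m = n^(1/K), which tends to infinity; Chebyshev at half the mean gives x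
   / (x/2)^2 = 4/x. *)
have min_prob n : (1 < n)%N ->
    fine (P [set w | #|[pred k | Q0 n k w <= s n m]|%:R < n%:R * s n m / 2]) <=
    4 * n%:R `^ (- K^-1).
  move=> n1.
  have n1' : 1 < n%:R :> R by rewrite ltr1n.
  have n0' : 0 < n%:R :> R by apply: lt_trans n1'.
  have s0 : 0 < s n m by rewrite powR_gt0.
  have s1 : s n m < 1.
    rewrite /s powRN invf_lt1 ?powR_gt0//.
    have mK0 : 0 < m%:R / K by rewrite divr_gt0 ?ltr0n.
    by have := gt0_ltr_powR mK0 _ _ n1'; rewrite powR1; apply; rewrite nnegrE// ltW.
  have ns0 : 0 < n%:R * s n m by rewrite mulr_gt0.
  apply: le_trans (card_uniform_lt (mQ n) (PQ n) (@indepQ n) _ _) _.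
  - by rewrite s0.
  - lra.
  - have -> : n%:R `^ (- K^-1) = (n%:R * s n m)^-1.
      rewrite powRN /s mK -{2}[n%:R](powRr1 (ltW n0')) -powRD.
        by congr ((_ `^ _)^-1); ring.
      by rewrite (gt_eqF n0') implybT.
    move: (n%:R * s n m) ns0 => x x0.
    rewrite le_eqVlt; apply/orP; left; apply/eqP; field.
    by rewrite (gt_eqF x0).
have lln_prob n : (1 < n)%N ->
    fine (P [set w | #|[pred k | Q0 n k w <= gamma1]|%:R < gamma0 * n%:R]) <=
    gamma1 / (gamma1 - gamma0) ^+ 2 * n%:R `^ (- 1).
  move=> n1.
  have n1' : 1 < n%:R :> R by rewrite ltr1n.
  have n0' : 0 < n%:R :> R by apply: lt_trans n1'.
  apply: le_trans (card_uniform_lt (mQ n) (PQ n) (@indepQ n) _ _) _.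
  - by rewrite g11 (lt_trans g0).
  - by rewrite mulrC ltr_pM2l.
  - rewrite (powR_inv1 (ltW n0')) le_eqVlt; apply/orP; left; apply/eqP; field.
    by rewrite (gt_eqF n0') [gamma0 * _]mulrC -mulrBr mulf_eq0 (gt_eqF n0') subr_eq0
      (gt_eqF g01).
pose u n : R := m.+1%:R * (n%:R `^ (- (en / 4)) / c') +
  (4 * n%:R `^ (- K^-1) + gamma1 / (gamma1 - gamma0) ^+ 2 * n%:R `^ (- 1)).
have u0 : u n @[n --> \oo] --> (0 : R).
  rewrite (_ : 0 = m.+1%:R * (0 / c') + (4 * 0 + gamma1 / (gamma1 - gamma0) ^+ 2 * 0));
    last by rewrite mul0r !mulr0 !addr0.
  apply: cvgD; [|apply: cvgD].
  - by apply: cvgMr; apply: cvgMl; apply: powR_natN_cvg0; rewrite divr_gt0.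
  - by apply: cvgMr; apply: powR_natN_cvg0; rewrite invr_gt0.
  - by apply: cvgMr; exact: powR_natN_cvg0.
apply: (@squeeze_cvge _ _ _ _ (cst 0%E) (fun n => P _) (fun n => (u n)%:E)).
- near=> n; rewrite measure_ge0/=.
  have n1 : (1 < n)%N by near: n; exact: nbhs_infty_gt.
  have n1' : 1 < n%:R :> R by rewrite ltr1n.
  have n0' : 0 < n%:R :> R by apply: lt_trans n1'.
  have dn : delta n <= en / 4.
    by near: n; apply: (cvgr_le _ dl0); rewrite divr_gt0.
  rewrite -[leLHS]fineK ?fin_num_measure//; last exact: measurable_HC_gt.
  rewrite lee_fin.
  apply: le_trans (@HC_gt_prob_le R d T P n (Ind n) (Q0 n) (Y n) (mInd n) (mQ n) (mY n)
    gamma0 gamma1 c c' (s n) m (n%:R * s n m / 2) _ _ _ _ _ _ _ (Q0null n) (Ynull n)) _.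
  + exact: ltW.
  + by [].
  + by rewrite /s mul0r oppr0 powRr0.
  + by move=> k; rewrite powR_gt0.
  + by rewrite !mulr_gt0// powR_gt0.
  + by rewrite ge_min lexx.
  (* The grid point of index m + 1 = K is exactly 1/n, so the threshold at k = m is [c'] itself. *)
  + have -> : Num.sqrt n%:R * Num.sqrt (s n m.+1) = 1.
      rewrite -(sqrtrM _ (ltW n0')) /s divff ?gt_eqF// powR_inv1 ?ltW// divff ?gt_eqF//.
      by rewrite sqrtr1.
    by rewrite mulr1 gt_min; apply/orP; right; lra.
  apply: lerD; last by apply: lerD; [exact: min_prob|exact: lln_prob].
  apply: (@le_trans _ _ (\sum_(k < m.+1) (n%:R `^ (- (en / 4)) / c'))).
    by apply: ler_sum => k _; apply: grid_prob => //; rewrite -ltnS.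
  by rewrite sumr_const card_ord mulr_natl.
- exact: cvg_cst.
- by apply: cvg_EFin; [exact: nearW|exact: u0].
Unshelve. all: by end_near. Qed.
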